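(* Let $A \in \mathbb{R}^{m\times n}$ have rows $a_1^T,\dots,a_m^T$ normalized so that $\|a_i\|^2 = 1$ for all $i$, let $b \in \mathbb{R}^m$, and suppose the feasible region $P = \{x \in \mathbb{R}^n : Ax \le b\}$ is nonempty. Let $0 < \lambda \le 2$, let $1 \le \beta \le m$, let $x_0 \in \mathbb{R}^n$, and let $(x_k)_{k\ge 0}$ be the iterates of the SKM method on $Ax \le b$ with sample size $\beta$ and projection parameter $\lambda$. Let $s_{k-1}$ be the number of constraints of $Ax\le b$ satisfied by $x_{k-1}$ and let $V_{k-1} = \max\{m - s_{k-1},\, m - \beta + 1\}$. Let $L_2$ be a Hoffman constant of the system. Then the method converges at least linearly in expectation, in the following sense: for every $k \ge 1$, taking expectation over the choice of the $k$th sample conditionally on the previous samples, $$\mathbb{E}\big[d(x_k,P)^2 \,\big|\, \tau_1,\dots,\tau_{k-1}\big] \le \left(1 - \frac{2\lambda - \lambda^2}{V_{k-1} L_2^2}\right) d(x_{k-1},P)^2,$$ and, taking expectation over all the samples, $$\mathbb{E}\big[d(x_k,P)^2\big] \le \left(1 - \frac{2\lambda - \lambda^2}{m L_2^2}\right)^k d(x_0,P)^2.$$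
   Context: The SKM (Sampling Kaczmarz-Motzkin) method with sample size $\beta$ and projection parameter $\lambda \in (0,2]$ on a system $Ax \le b$ (with rows $a_i^T$) generates, from a given deterministic $x_0$, random iterates as follows. For $k = 1,2,\dots$: (1) choose a subset $\tau_k \subseteq \{1,\dots,m\}$ of size $\beta$ uniformly at random among all such subsets, independently of earlier choices; (2) let $t_k \in \operatorname{argmax}_{i \in \tau_k} (a_i^T x_{k-1} - b_i)$; (3) set $x_k = x_{k-1} - \lambda \frac{(a_{t_k}^T x_{k-1} - b_{t_k})^+}{\|a_{t_k}\|^2} a_{t_k}$. For a real number or vector $z$, $z^+$ denotes its (entrywise) positive part, i.e. positive entries are kept and other entries are replaced by zero. $\|\cdot\|$ is the Euclidean norm and $d(x,P)$ is the Euclidean distance from $x$ to $P$. A Hoffman constant $L_2>0$ of the feasible system $Ax\le b$ is a constant such that $d(x,P) \le L_2 \|(Ax-b)^+\|_2$ for all $x \in \mathbb{R}^n$. *)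

(* Defs.v *)
From HB Require Import structures.
From mathcomp Require Export all_boot all_order all_algebra.
From mathcomp Require Export all_classical all_reals all_analysis.
Export Order.TTheory GRing.Theory Num.Theory.
Export numFieldNormedType.Exports.

Set Implicit Arguments.
Unset Strict Implicit.
Unset Printing Implicit Defensive.

Local Open Scope classical_set_scope.
Local Open Scope ring_scope.

(* The library norm on matrices is the sup norm, hence a separate Euclidean
   norm. *)
Definition enorm {R : realType} {n : nat} (x : 'cV[R]_n) : R :=
  Num.sqrt (\sum_(i < n) x i 0 ^+ 2).

Definition edist {R : realType} {n : nat} (x : 'cV[R]_n)
    (S : set 'cV[R]_n) : R :=
  inf [set enorm (x - y) | y in S].

Definition pos_part {R : realType} (z : R) : R := Num.max z 0.

Definition arow {R : realType} {m n : nat} (A : 'M[R]_(m, n)) (i : 'I_m) :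
  'cV[R]_n := (row i A)^T.

Definition residual {R : realType} {m n : nat} (A : 'M[R]_(m, n))
    (b : 'cV[R]_m) (x : 'cV[R]_n) (i : 'I_m) : R :=
  (A *m x) i 0 - b i 0.

Definition feasible {R : realType} {m n : nat} (A : 'M[R]_(m, n))
    (b : 'cV[R]_m) : set 'cV[R]_n :=
  [set x | forall i : 'I_m, (A *m x) i 0 <= b i 0].

Definition hoffman_constant {R : realType} {m n : nat} (A : 'M[R]_(m, n))
    (b : 'cV[R]_m) (L : R) : Prop :=
  0 < L /\
  forall x : 'cV[R]_n,
    edist x (feasible A b) <= L * enorm (map_mx pos_part (A *m x - b)).

Definition num_satisfied {R : realType} {m n : nat} (A : 'M[R]_(m, n))
    (b : 'cV[R]_m) (x : 'cV[R]_n) : nat :=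
  #|[set i : 'I_m | (A *m x) i 0 <= b i 0]%SET|.

(* V = max {m - s, m - beta + 1}, s being the number of constraints satisfied
   by x; the subtractions are exact since s <= m and beta <= m. *)
Definition skm_V {R : realType} {m n : nat} (A : 'M[R]_(m, n))
    (b : 'cV[R]_m) (beta : nat) (x : 'cV[R]_n) : nat :=
  maxn (m - num_satisfied A b x) (m - beta + 1).

Definition skm_step {R : realType} {m n : nat} (A : 'M[R]_(m, n))
    (b : 'cV[R]_m) (lambda : R) (x : 'cV[R]_n) (i : 'I_m) : 'cV[R]_n :=
  x - (lambda * (pos_part (residual A b x i) / enorm (arow A i) ^+ 2))
        *: arow A i.

(* Samples are numbered from 1: tau 0 is unused and unconstrained.
   Independence is mutual independence of the whole family (tau k)_(k >= 1),
   i.e. the product rule for every finite subfamily. *)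
Record uniform_samples {d : measure_display} {Omega : measurableType d}
    {R : realType} (Pr : probability Omega R) {m : nat} (beta : nat)
    (tau : nat -> Omega -> {set 'I_m}) : Prop := UniformSamples {
  samples_card : forall k w, (1 <= k)%N -> #|tau k w| = beta ;
  samples_measurable : forall k (S : {set 'I_m}), (1 <= k)%N ->
    measurable (tau k @^-1` [set S]) ;
  samples_uniform : forall k (S : {set 'I_m}), (1 <= k)%N -> #|S| = beta ->
    Pr (tau k @^-1` [set S]) = (('C(m, beta))%:R^-1)%:E ;
  samples_independent : forall (J : seq nat) (B : nat -> set {set 'I_m}),
    uniq J -> all (fun j => (1 <= j)%N) J ->
    Pr (\bigcap_(j in [set` J]) (tau j @^-1` B j)) =
      (\prod_(j <- J) Pr (tau j @^-1` B j))%E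
}.

(* Ties in the argmax may be broken in any way that depends only on the samples
   drawn so far (skm_adapted); in particular x_k is a function of
   tau_1, ..., tau_k. The index t 0 is unused. *)
Record is_skm {Omega : Type} {R : realType} {m n : nat} (A : 'M[R]_(m, n))
    (b : 'cV[R]_m) (lambda : R) (x0 : 'cV[R]_n)
    (tau : nat -> Omega -> {set 'I_m}) (t : nat -> Omega -> 'I_m)
    (x : nat -> Omega -> 'cV[R]_n) : Prop := IsSKM {
  skm_init : forall w, x 0%N w = x0 ;
  skm_argmax_in : forall k w, t k.+1 w \in tau k.+1 w ;
  skm_argmax_ge : forall k w (i : 'I_m), i \in tau k.+1 w ->
    residual A b (x k w) i <= residual A b (x k w) (t k.+1 w) ;
  skm_adapted : forall k w w',
    (forall j, (1 <= j <= k.+1)%N -> tau j w = tau j w') ->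
    t k.+1 w = t k.+1 w' ;
  skm_next : forall k w, x k.+1 w = skm_step A b lambda (x k w) (t k.+1 w)
}.

(* The event that tau_1, ..., tau_{k-1} take the values they have at w. *)
Definition past_event {Omega : Type} {m : nat}
    (tau : nat -> Omega -> {set 'I_m}) (k : nat) (w : Omega) : set Omega :=
  [set w' | forall j, (1 <= j < k)%N -> tau j w' = tau j w].

(* E[X | tau_1, ..., tau_{k-1}] at w. The conditioning variables take finitely
   many values, so this is the elementary conditional expectation
   E[X 1_H] / Pr(H) on the atom H of sigma(tau_1, ..., tau_{k-1}) containing w;
   for uniform_samples every such atom has positive probability. *)
Definition cond_expectation_past {d : measure_display}
    {Omega : measurableType d} {R : realType} (Pr : probability Omega R)
    {m : nat} (tau : nat -> Omega -> {set 'I_m}) (k : nat) (X : Omega -> R)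
    (w : Omega) : \bar R :=
  ((\int[Pr]_(w' in past_event tau k w) (X w')%:E) *
     ((fine (Pr (past_event tau k w)))^-1)%:E)%E.

(* Main.v *)
Require Import Defs.
From mathcomp Require Import measurable_realfun ring lra zify.
Set Implicit Arguments.
Unset Strict Implicit.
Unset Printing Implicit Defensive.
Local Open Scope classical_set_scope.
Local Open Scope ring_scope.

(** The bound for one step rests on two independent facts.

    Geometry: moving from [x] along the unit normal of row [i] by [lambda] times
    the violation [r] decreases the squared distance to every feasible [y] by at
    least [(2 * lambda - lambda ^+ 2) * r ^+ 2], because
    [a_i^T (x - y) >= a_i^T x - b_i]. As the decrease does not depend on [y], it
    passes to the infimum, and no projection onto the polyhedron is needed
    ([skm_step_sqr]).

    Combinatorics: for a nonnegative [f] on [m] points, the average over all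
    [beta]-subsets of the maximum of [f] is at least the sum of [f] divided by
    [V], for any [V] that bounds both the number of nonzero values of [f] and
    [m - beta + 1] ([mean_max_ge]). Instead of sorting the values, one draws a
    [beta]-subset by first drawing a subset [T] of size [beta - 1] and then one
    more point outside [T]; the inequality already holds conditionally on [T]
    ([sum_punctured_subset]).

    With [f] the squared violations, Hoffman's inequality turns their sum into a
    squared distance, which gives [skm_mean_step]: a statement about a plain
    average over [beta]-subsets. The passage to probability only uses that all
    random quantities at time [k] are functions of the finitely valued history
    [tau_1, ..., tau_k]. Independence and uniformity make all nonnegligible
    histories of length [k] equally likely, so that the conditional expectation
    given the past is exactly that plain average ([integral_next_le]). Summing
    over the pasts and replacing [V] by its upper bound [m] gives a recursion for
    the unconditional expectations ([expectation_step]), which is then iterated.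
*)

(** * Averages of maxima over subsets of a given size *)

(** Think of [h i] as the maximum of [f] over [i |: T] and of [M] as its maximum
    over [T]. The values of [f] inside [T] seem lost on the right, but each point
    outside [T] where [f] vanishes still contributes [M]; the bound on the number
    of nonzero values guarantees that there are enough such points, up to the
    factor [V / #|~: T|], to pay for the at most [M] lost at each point of [T]
    where [f] is nonzero. *)
Lemma sum_punctured_subset (R : realFieldType) (I : finType) (T : {set I})
    (f h : I -> R) (M V : R) :
  0 <= M ->
  (forall i, 0 <= f i) ->
  (forall i, i \in T -> f i <= M) ->
  (forall i, i \notin T -> f i <= h i /\ M <= h i) ->
  \sum_i (f i != 0)%:R <= V ->
  #|~: T|%:R <= V ->
  #|~: T|%:R * \sum_i f i <= V * \sum_(i | i \notin T) h i.
Proof.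
move=> M0 f0 fM fh suppV cTV.
have cTE : (#|~: T|%:R : R) = \sum_(i | i \notin T) 1.
  by rewrite -sum1_card natr_sum; apply: eq_bigl => i; rewrite inE.
rewrite (bigID (mem T)) /=.
rewrite (bigID (mem T)) /= in suppV.
set Fi := \sum_(i in T) f i.
set Fo := \sum_(i | i \notin T) f i.
set u := \sum_(i in T) _ in suppV.
set v := \sum_(i | i \notin T) _ in suppV.
(* [u] and [v] count the nonzero values of [f] inside and outside [T]. *)
have Fiu : Fi <= u * M.
  rewrite mulr_suml; apply: ler_sum => i iT.
  by have [->|_] := eqVneq (f i) 0; rewrite ?mul0r // mul1r fM.
set S := \sum_(i | i \notin T) h i.
have SN : #|~: T|%:R * M <= S.
  rewrite cTE mulr_suml; apply: ler_sum => i iT.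
  by rewrite mul1r; case: (fh i iT).
have Sv : Fo + (#|~: T|%:R - v) * M <= S.
  rewrite cTE -sumrB mulr_suml -big_split /=; apply: ler_sum => i iT.
  have [fhi Mhi] := fh i iT.
  by have [->|_] := eqVneq (f i) 0; rewrite /= ?subr0 ?subrr ?mul0r ?mul1r ?add0r ?addr0.
set N := (#|~: T|%:R : R) in SN Sv cTV *.
have N0 : 0 <= N by rewrite ler0n.
have h1 : N * (Fi + Fo) <= N * (S + (u + v - N) * M).
  by apply: ler_wpM2l => //; nra.
have h2 : N * M * (u + v - N) <= N * M * (V - N).
  by apply: ler_wpM2l; [exact: mulr_ge0 | lra].
have h3 : (V - N) * (N * M) <= (V - N) * S.
  by apply: ler_wpM2l => //; lra.
nra.
Qed.

(** Double counting of the pairs [(S, i)] with [i \in S]: such a pair amounts to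
    the set [T = S :\ i] together with the point [i] outside it. *)
Lemma sum_subsets_split (R : realFieldType) (I : finType) (beta : nat)
    (g : {set I} -> R) :
  (0 < beta)%N ->
  beta%:R * \sum_(S : {set I} | #|S| == beta) g S =
  \sum_(T : {set I} | #|T| == beta.-1) \sum_(i | i \notin T) g (i |: T)%SET.
Proof.
move=> beta0.
transitivity (\sum_(S : {set I} | #|S| == beta) \sum_(i in S) g S).
  rewrite mulr_sumr; apply: eq_bigr => S /eqP cS.
  by rewrite sumr_const cS mulr_natl.
rewrite (exchange_big_dep xpredT) //= [RHS](exchange_big_dep xpredT) //=.
apply: eq_bigr => i _.
rewrite (reindex_onto (fun T => i |: T)%SET (fun S => S :\ i)%SET) /=; last first.
  by move=> S /andP[_ iS]; rewrite finset.setD1K.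
apply: eq_bigl => T.
have [iT|iT] := boolP (i \in T).
  rewrite andbF; apply/negP => /andP[_ /eqP].
  by move/setP/(_ i); rewrite !inE eqxx iT.
by rewrite setU11 andbT cardsU1 iT add1n setU1K // eqxx andbT andbT -{1}(prednK beta0) eqSS.
Qed.

(** Averaging [sum_punctured_subset] over all [T] of size [beta - 1]. The function
    [g] stands for the maximum of [f] over a set. *)
Lemma mean_max_ge (R : realFieldType) (I : finType) (beta : nat) (f : I -> R)
    (g : {set I} -> R) (V : R) :
  (0 < beta <= #|I|)%N ->
  (forall i, 0 <= f i) ->
  (forall (S : {set I}) i, #|S| = beta -> i \in S -> f i <= g S) ->
  \sum_i (f i != 0)%:R <= V ->
  (#|I| - beta + 1)%:R <= V ->
  ('C(#|I|, beta))%:R * \sum_i f i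
    <= V * \sum_(S : {set I} | #|S| == beta) g S.
Proof.
move=> /andP[beta0 betam] f0 fg suppV NV.
have b0 : 0 < (beta%:R : R) by rewrite ltr0n.
rewrite -(ler_pM2l b0) [leRHS]mulrCA sum_subsets_split //.
have -> : beta%:R * (('C(#|I|, beta))%:R * \sum_i f i) =
    \sum_(T : {set I} | #|T| == beta.-1) (#|I| - beta + 1)%:R * \sum_i f i.
  rewrite sumr_const -[RHS]mulr_natl !mulrA -!natrM; congr (_%:R * _).
  have -> : #|[pred T : {set I} | #|T| == beta.-1]| = 'C(#|I|, beta.-1).
    by rewrite -card_draws cardsE.
  rewrite mulnC [RHS]mulnC.
  case: beta beta0 betam {fg b0 NV} => // k _ km /=.
  by rewrite mulnC mul_bin_left addn1 subnSK.
rewrite [leRHS]mulr_sumr; apply: ler_sum => T /eqP cT.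
have cTC : #|~: T|%SET = (#|I| - beta + 1)%N.
  by rewrite cardsCs finset.setCK cT; lia.
rewrite -cTC.
have cU i : i \notin T -> #|i |: T|%SET = beta.
  by move=> iT; rewrite cardsU1 iT cT add1n prednK.
apply: (@sum_punctured_subset _ _ _ _ _ (\big[Num.max/0]_(j in T) f j)) => //.
- exact: bigmax_ge_id.
- by move=> i iT; exact: le_bigmax_cond.
- move=> i iT; have fgi : f i <= g (i |: T)%SET.
    by apply: fg; [exact: cU | exact: setU11].
  split=> //; apply: bigmax_le => [|j jT]; first exact: le_trans fgi.
  by apply: fg; [exact: cU | rewrite setU1r].
- by rewrite cTC.
Qed.

(** * One projection step *)

Definition edot (R : realType) (n : nat) (x y : 'cV[R]_n) : R :=
  \sum_(i < n) x i 0 * y i 0.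

Lemma enorm_ge0 (R : realType) (n : nat) (x : 'cV[R]_n) : 0 <= enorm x.
Proof. exact: sqrtr_ge0. Qed.

Lemma enorm_sqr (R : realType) (n : nat) (x : 'cV[R]_n) :
  enorm x ^+ 2 = \sum_(i < n) x i 0 ^+ 2.
Proof. by rewrite sqr_sqrtr // sumr_ge0 // => i _; exact: sqr_ge0. Qed.

Lemma enormBZ_sqr (R : realType) (n : nat) (x a : 'cV[R]_n) (c : R) :
  enorm (x - c *: a) ^+ 2 =
  enorm x ^+ 2 - 2 * c * edot a x + c ^+ 2 * enorm a ^+ 2.
Proof.
rewrite !enorm_sqr !mulr_sumr -sumrB -big_split /=.
by apply: eq_bigr => i _; rewrite !mxE; ring.
Qed.

Lemma edot_arow (R : realType) (m n : nat) (A : 'M[R]_(m, n)) i (x : 'cV_n) :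
  edot (arow A i) x = (A *m x) i 0.
Proof. by rewrite mxE; apply: eq_bigr => j _; rewrite !mxE. Qed.

Section Edist.
Variables (R : realType) (n : nat) (S : set 'cV[R]_n).
Hypothesis S0 : S !=set0.

Lemma edist_le (x y : 'cV[R]_n) : S y -> edist x S <= enorm (x - y).
Proof.
move=> Sy; apply: ge_inf; last by exists y.
by exists 0 => _ [z _ <-]; exact: enorm_ge0.
Qed.

Lemma edist_glb (x : 'cV[R]_n) (r : R) :
  (forall y, S y -> r <= enorm (x - y)) -> r <= edist x S.
Proof.
move=> h; apply: lb_le_inf; first by case: S0 => y Sy; exists (enorm (x - y)); exists y.
by move=> _ [y Sy <-]; exact: h.
Qed.

Lemma edist_ge0 (x : 'cV[R]_n) : 0 <= edist x S.
Proof. by apply: edist_glb => y _; exact: enorm_ge0. Qed.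

(** A decrease of the squared distance that is uniform in the target point
    survives taking the infimum over target points. *)
Lemma edist_sqr_drop (x x' : 'cV[R]_n) (c : R) : 0 <= c ->
  (forall y, S y -> enorm (x' - y) ^+ 2 + c <= enorm (x - y) ^+ 2) ->
  edist x' S ^+ 2 + c <= edist x S ^+ 2.
Proof.
move=> c0 h.
have d0 : 0 <= edist x' S ^+ 2 + c by rewrite addr_ge0 // sqr_ge0.
rewrite -[leLHS]sqr_sqrtr // ler_sqr ?nnegrE ?sqrtr_ge0 ?edist_ge0 //.
apply: edist_glb => y Sy.
by rewrite -[leRHS]ger0_norm ?enorm_ge0 // -sqrtr_sqr ler_wsqrtr // (le_trans _ (h y Sy)) //
  lerD2r ler_sqr ?nnegrE ?enorm_ge0 ?edist_ge0 ?edist_le.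
Qed.
End Edist.

(** Expanding the square leaves the excess [2 * lambda * r * (b_i - a_i^T y)],
    where [r] is the violation; it is nonnegative because [y] satisfies
    constraint [i]. *)
Lemma skm_step_sqr (R : realType) (m n : nat) (A : 'M[R]_(m, n)) (b : 'cV[R]_m)
    (lambda : R) (x : 'cV[R]_n) (i : 'I_m) :
  enorm (arow A i) ^+ 2 = 1 -> feasible A b !=set0 -> 0 <= lambda <= 2 ->
  edist (skm_step A b lambda x i) (feasible A b) ^+ 2
    + (2 * lambda - lambda ^+ 2) * pos_part (residual A b x i) ^+ 2
  <= edist x (feasible A b) ^+ 2.
Proof.
move=> ai P0 /andP[l0 l2]; apply: edist_sqr_drop => // [|y Py].
  by rewrite mulr_ge0 ?sqr_ge0 //; nra.
rewrite /skm_step ai divr1 addrAC enormBZ_sqr ai edot_arow.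
have -> : (A *m (x - y)) i 0 = (A *m x) i 0 - (A *m y) i 0.
  by rewrite mulmxBr [LHS]mxE [X in _ + X = _]mxE.
have := Py i; rewrite /residual /pos_part.
set u := (A *m x) i 0; set v := (A *m y) i 0; set c := b i 0 => vc.
have [r0|r0] := lerP (u - c) 0; first by nra.
have : 0 <= lambda * (u - c) * (c - v).
  by rewrite !mulr_ge0 ?(subr_ge0 v) //; exact: ltW.
nra.
Qed.

Lemma residuals_hoffman (R : realType) (m n : nat) (A : 'M[R]_(m, n))
    (b : 'cV[R]_m) (L : R) (x : 'cV[R]_n) :
  feasible A b !=set0 -> hoffman_constant A b L ->
  edist x (feasible A b) ^+ 2 / L ^+ 2
    <= \sum_i pos_part (residual A b x i) ^+ 2.
Proof.
move=> P0 [L0 /(_ x) h].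
rewrite ler_pdivrMr ?exprn_gt0 // mulrC.
have -> : \sum_i pos_part (residual A b x i) ^+ 2 =
    enorm (map_mx pos_part (A *m x - b)) ^+ 2.
  by rewrite enorm_sqr; apply: eq_bigr => i _; rewrite /residual !mxE.
rewrite -exprMn ler_sqr // nnegrE ?edist_ge0 // mulr_ge0 ?enorm_ge0 // ltW //.
Qed.

(** The expected one-step contraction, with the expectation over the sample
    written as an average over [beta]-subsets. The function [t] is an arbitrary
    selection of a maximal residual. *)
Lemma skm_mean_step (R : realType) (m n : nat) (A : 'M[R]_(m, n))
    (b : 'cV[R]_m) (lambda : R) (beta : nat) (L : R) (x : 'cV[R]_n)
    (t : {set 'I_m} -> 'I_m) :
  (forall i : 'I_m, enorm (arow A i) ^+ 2 = 1) ->
  feasible A b !=set0 -> 0 <= lambda <= 2 -> (1 <= beta <= m)%N ->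
  hoffman_constant A b L ->
  (forall (S : {set 'I_m}) i, #|S| = beta -> i \in S ->
    residual A b x i <= residual A b x (t S)) ->
  ('C(m, beta))%:R^-1 * (\sum_(S : {set 'I_m} | #|S| == beta)
      edist (skm_step A b lambda x (t S)) (feasible A b) ^+ 2)
  <= (1 - (2 * lambda - lambda ^+ 2) / ((skm_V A b beta x)%:R * L ^+ 2))
      * edist x (feasible A b) ^+ 2.
Proof.
move=> hA P0 hl hb hL ht.
set P := feasible A b; set V := skm_V A b beta x.
set c := 2 * lambda - lambda ^+ 2.
set r := fun i => pos_part (residual A b x i) ^+ 2.
have c0 : 0 <= c by case/andP: hl => l0 l2; rewrite /c; nra.
have L0 : 0 < L by case: hL.
have V0 : 0 < (V%:R : R) by rewrite ltr0n /V /skm_V; lia.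
have C0 : 0 < ('C(m, beta)%:R : R) by rewrite ltr0n bin_gt0; case/andP: hb.
have pp_ge0 z : 0 <= pos_part z :> R by rewrite le_max lexx orbT.
have mean : ('C(m, beta))%:R * \sum_i r i
    <= V%:R * \sum_(S : {set 'I_m} | #|S| == beta) r (t S).
  rewrite -[m in 'C(m, _)]card_ord; apply: mean_max_ge.
  - by rewrite card_ord.
  - by move=> i; exact: sqr_ge0.
  - move=> S i cS iS; rewrite /r ler_sqr ?nnegrE //.
    by rewrite /pos_part ge_max !le_max lexx orbT andbT ht.
  - rewrite -natr_sum ler_nat.
    apply: (@leq_trans (m - num_satisfied A b x)); last exact: leq_maxl.
    have -> : (m - num_satisfied A b x)%N
        = #|~: [set i : 'I_m | (A *m x) i 0 <= b i 0]|%SET.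
      by rewrite cardsCs finset.setCK card_ord.
    rewrite -sum1_card [leqRHS]big_mkcond; apply: leq_sum => i _;
    rewrite !inE /r /pos_part.
    have [rle|rgt] := lerP (residual A b x i) 0; first by rewrite expr0n eqxx.
    by rewrite -ltNge -subr_gt0 rgt; case: (_ != 0).
  - by rewrite /= card_ord ler_nat leq_maxr.
have hoff : edist x P ^+ 2 / L ^+ 2 <= \sum_i r i by exact: residuals_hoffman.
have cardb : (\sum_(S : {set 'I_m} | #|S| == beta) 1 : R) = 'C(m, beta)%:R.
  by rewrite sumr_const -[in RHS](card_ord m) -card_draws cardsE.
rewrite ler_pdivrMl //.
apply: (@le_trans _ _ (\sum_(S : {set 'I_m} | #|S| == beta)
    (1 * edist x P ^+ 2 - c * r (t S)))).
  apply: ler_sum => S _; rewrite mul1r lerBrDr; exact: skm_step_sqr.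
rewrite sumrB -mulr_suml cardb -mulr_sumr [leRHS]mulrA mulrBr mulr1 [leRHS]mulrBl.
apply: lerB => //.
apply: (@le_trans _ _ (c * ('C(m, beta)%:R * (\sum_i r i) / V%:R))); last first.
  by apply: ler_wpM2l => //; rewrite ler_pdivrMr // [leRHS]mulrC.
have -> : 'C(m, beta)%:R * (c / (V%:R * L ^+ 2)) * edist x P ^+ 2
    = c * ('C(m, beta)%:R * (edist x P ^+ 2 / L ^+ 2) / V%:R).
  by rewrite invfM; ring.
by apply: ler_wpM2l => //; rewrite ler_pM2r ?invr_gt0 // ler_pM2l.
Qed.

(** * Integrals of finitely valued random variables *)

Section FiniteValued.
Context {d : measure_display} {Omega : measurableType d} {R : realType}.
Variables (Pr : probability Omega R) (T : finType) (X : Omega -> T).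
Hypothesis mX : forall a, measurable (X @^-1` [set a]).

Lemma finite_valued_sumE (f : T -> R) (w : Omega) :
  f (X w) = \sum_a f a * \1_(X @^-1` [set a]) w.
Proof.
rewrite (bigD1 (X w)) //= big1 => [|a aX]; last first.
  rewrite indicE memNset ?mulr0 // => /= Xa.
  by rewrite -Xa eqxx in aX.
by rewrite indicE mem_set // mulr1 addr0.
Qed.

Lemma measurable_finite_valued (D : set Omega) (f : T -> R) :
  measurable_fun D (fun w => f (X w)).
Proof.
under eq_fun do rewrite finite_valued_sumE.
apply: measurable_sum => a.
by apply: measurable_funM => //; exact: measurable_indic.
Qed.

Lemma integral_finite_valued (D : set Omega) (f : T -> R) :
  measurable D -> (forall a, 0 <= f a) ->
  (\int[Pr]_(w in D) (f (X w))%:E =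
     \sum_a (f a)%:E * Pr (D `&` X @^-1` [set a]))%E.
Proof.
move=> mD f0.
under eq_integral do rewrite finite_valued_sumE -sumEFin.
have mI a : measurable_fun D (fun w => (\1_(X @^-1` [set a]) w)%:E : \bar R).
  by apply/measurable_EFinP; exact: measurable_indic.
rewrite ge0_integral_sum //.
- apply: eq_bigr => a _; under eq_integral do rewrite EFinM.
  rewrite ge0_integralZl_EFin //.
    by rewrite integral_indic // setIC.
- by move=> a; apply/measurable_EFinP; apply: measurable_funM => //; exact: measurable_indic.
- by move=> a w _; rewrite lee_fin mulr_ge0.
Qed.

Lemma integral_fibers (g : Omega -> R) :
  measurable_fun setT (EFin \o g) -> (forall w, 0 <= g w) ->
  (\int[Pr]_w (g w)%:E = \sum_a \int[Pr]_(w in X @^-1` [set a]) (g w)%:E)%E.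
Proof.
move=> mg g0.
have XT : \big[setU/set0]_(a <- index_enum T) (X @^-1` [set a]) = setT.
  apply/seteqP; split=> // w _; rewrite -bigcup_seq /=.
  by exists (X w) => //=; exact: mem_index_enum.
rewrite -XT ge0_integral_bigsetU //.
- exact: index_enum_uniq.
- by move=> a a' _ _ [w []]; rewrite /preimage /= => <- <-.
- by rewrite XT.
- by move=> w _; rewrite lee_fin.
Qed.

End FiniteValued.

(** * Histories of the samples *)

Section History.
Variables (Omega : Type) (m : nat) (tau : nat -> Omega -> {set 'I_m}).

(** The shift makes the entries the samples numbered [1] to [k]. *)
Definition history (k : nat) (w : Omega) : {ffun 'I_k -> {set 'I_m}} :=
  [ffun j : 'I_k => tau j.+1 w].

Lemma historyP k w w' :
  history k w = history k w' <->
  (forall j, (1 <= j <= k)%N -> tau j w = tau j w').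
Proof.
split=> [/ffunP h [//|j] jk|h].
  by have := h (Ordinal jk); rewrite !ffunE; apply.
by apply: eq_ffun => j; apply: h; exact: (ltn_ord j).
Qed.

Lemma past_eventE k w :
  past_event tau k.+1 w = history k @^-1` [set history k w].
Proof.
by apply/seteqP; split=> w' /=; [move=> h; apply/historyP | move/historyP].
Qed.

End History.

Section Samples.
Context {d : measure_display} {Omega : measurableType d} {R : realType}.
Variables (Pr : probability Omega R) (m beta : nat).
Variable tau : nat -> Omega -> {set 'I_m}.
Hypothesis htau : uniform_samples Pr beta tau.

Lemma measurable_history k h : measurable (history tau k @^-1` [set h]).
Proof.
have -> : history tau k @^-1` [set h]
    = \bigcap_(j in [set: 'I_k]) (tau j.+1 @^-1` [set h j]).
  apply/seteqP; split=> w /= => [<- j _|hw]; first by rewrite /= ffunE.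
  by apply/ffunP => j; rewrite ffunE; exact: hw.
by apply: fin_bigcap_measurable => // j _; exact: samples_measurable htau _ _ _.
Qed.

(** The value does not depend on [s]: all possible histories are equally
    likely. *)
Lemma prob_prefix k (s : nat -> {set 'I_m}) :
  (forall j, (1 <= j <= k)%N -> #|s j| = beta) ->
  Pr [set w | forall j, (1 <= j <= k)%N -> tau j w = s j] =
  (('C(m, beta))%:R^-1 ^+ k)%:E.
Proof.
move=> cs.
have -> : [set w | forall j, (1 <= j <= k)%N -> tau j w = s j] =
    \bigcap_(j in [set` iota 1 k]) (tau j @^-1` [set s j]).
  by apply/seteqP; split=> w /= h j hj; apply: h; move: hj; rewrite /= mem_iota add1n ltnS.
rewrite (samples_independent htau (fun j => [set s j])) ?iota_uniq //; last first.
  by apply/allP => j; rewrite mem_iota => /andP[].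
rewrite (eq_big_seq (fun=> (('C(m, beta))%:R^-1)%:E)) => [|j]; last first.
  rewrite mem_iota add1n ltnS => hj; rewrite (samples_uniform htau) ?cs //.
  by case/andP: hj.
by rewrite prodEFin big_const_seq count_predT size_iota iter_mulr_1.
Qed.

Lemma prob_past k w :
  Pr (past_event tau k.+1 w) = (('C(m, beta))%:R^-1 ^+ k)%:E.
Proof.
by apply: prob_prefix => j /andP[j1 _]; exact: samples_card htau _ _ j1.
Qed.

Lemma prob_past_next k w (S : {set 'I_m}) : #|S| = beta ->
  Pr (past_event tau k.+1 w `&` tau k.+1 @^-1` [set S]) =
  (('C(m, beta))%:R^-1 ^+ k.+1)%:E.
Proof.
move=> cS.
rewrite -(prob_prefix (k := k.+1) (s := fun j => if j == k.+1 then S else tau j w)).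
  congr (Pr _); apply/seteqP; split=> w' /=.
    move=> [h hk] j /andP[j1 jk]; case: eqP => [->//|/eqP jk'].
    by apply: h; rewrite j1 ltn_neqAle jk' jk.
  move=> h; split=> [j /andP[j1 jk]|].
    by rewrite h ?j1 ?(ltnW jk) //; case: eqP => // jE; rewrite jE ltnn in jk.
  by rewrite h ?eqxx // leqnn.
by move=> j /andP[j1 _]; case: eqP => // _; exact: samples_card htau _ _ j1.
Qed.

End Samples.

(** * Conditional and total expectation of the squared distance *)

Lemma contraction_rate_le (R : realFieldType) (c L : R) (V m : nat) :
  0 <= c -> 0 < L -> (0 < V <= m)%N ->
  1 - c / (V%:R * L ^+ 2) <= 1 - c / (m%:R * L ^+ 2).
Proof.
move=> c0 L0 /andP[V0 Vm]; rewrite lerD2l lerN2; apply: ler_wpM2l => //.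
have m0 : (0 < m)%N by exact: leq_trans Vm.
rewrite lef_pV2 ?posrE ?mulr_gt0 ?exprn_gt0 ?ltr0n //.
by rewrite ler_pM2r ?exprn_gt0 // ler_nat.
Qed.

Lemma skm_V_bounds (R : realType) (m n : nat) (A : 'M[R]_(m, n))
    (b : 'cV[R]_m) (beta : nat) (x : 'cV[R]_n) :
  (1 <= beta <= m)%N -> (0 < skm_V A b beta x <= m)%N.
Proof. by move=> hb; rewrite /skm_V; lia. Qed.

Section SKM.
Context {d : measure_display} {Omega : measurableType d} {R : realType}.
Variables (Pr : probability Omega R) (m n beta : nat).
Variables (A : 'M[R]_(m, n)) (b : 'cV[R]_m) (lambda L : R) (x0 : 'cV[R]_n).
Variables (tau : nat -> Omega -> {set 'I_m}) (t : nat -> Omega -> 'I_m).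
Variable x : nat -> Omega -> 'cV[R]_n.
Hypothesis hA : forall i : 'I_m, enorm (arow A i) ^+ 2 = 1.
Hypothesis P0 : feasible A b !=set0.
Hypothesis hlambda : 0 <= lambda <= 2.
Hypothesis hbeta : (1 <= beta <= m)%N.
Hypothesis htau : uniform_samples Pr beta tau.
Hypothesis hx : is_skm A b lambda x0 tau t x.
Hypothesis hL : hoffman_constant A b L.

Let p : R := ('C(m, beta))%:R^-1.
Let dist2 k w : R := edist (x k w) (feasible A b) ^+ 2.
Let rate (V : nat) : R := 1 - (2 * lambda - lambda ^+ 2) / (V%:R * L ^+ 2).

Let p_gt0 : 0 < p.
Proof. by rewrite invr_gt0 ltr0n bin_gt0; case/andP: hbeta. Qed.

Lemma iterate_history k w w' :
  history tau k w = history tau k w' -> x k w = x k w'.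
Proof.
move/historyP; elim: k => [|k IH] h; first by rewrite !(skm_init hx).
rewrite !(skm_next hx) IH => [|j /andP[j1 jk]]; last by rewrite h // j1 leqW.
by rewrite (skm_adapted hx h).
Qed.

(** The conditional contraction, multiplied by the probability [p ^+ k] of the
    past. Given the past, the iterate [x k] is constant and the selected row is
    a function [tS] of the new sample alone, so the integral is an average over
    the values of that sample. *)
Lemma integral_next_le k w :
  (\int[Pr]_(w' in past_event tau k.+1 w) (dist2 k.+1 w')%:E
    <= (p ^+ k * (rate (skm_V A b beta (x k w)) * dist2 k w))%:E)%E.
Proof.
pose next S := past_event tau k.+1 w `&` tau k.+1 @^-1` [set S].
pose tS S := t k.+1 (xget w (next S)).
(* Every admissible sample has positive probability given the past, so it does
   occur; this is what makes [tS] meaningful on all sets of size [beta]. *)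
have nextP (S : {set 'I_m}) : #|S| = beta -> next S (xget w (next S)).
  move=> cS; suff [w' ?] : next S !=set0 by exact: (xgetPex w (ex_intro _ w' _)).
  apply/set0P/eqP => nS; have := prob_past_next htau k w cS.
  by rewrite -/(next S) nS measure0 => -[] /esym/eqP; rewrite expf_eq0 gt_eqF.
pose F S := edist (skm_step A b lambda (x k w) (tS S)) (feasible A b) ^+ 2.
have xk w' : past_event tau k.+1 w w' -> x k w' = x k w.
  by rewrite past_eventE; exact: iterate_history.
have dF w' : past_event tau k.+1 w w' -> dist2 k.+1 w' = F (tau k.+1 w').
  move=> pw'; have c' := samples_card htau w' (ltn0Sn k).
  rewrite /dist2 /F (skm_next hx) (xk _ pw').
  suff -> : t k.+1 w' = tS (tau k.+1 w') by [].
  have [pw'' tw''] := nextP _ c'.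
  apply: (skm_adapted hx) => j /andP[j1]; rewrite leq_eqVlt => /orP[/eqP ->|jk].
    exact: esym tw''.
  have j1k : (1 <= j < k.+1)%N by rewrite j1.
  by rewrite (pw' _ j1k) (pw'' _ j1k).
under eq_integral => w' /set_mem pw' do rewrite (dF _ pw').
have mp : measurable (past_event tau k.+1 w).
  by rewrite past_eventE; exact: measurable_history htau _ _.
rewrite (@integral_finite_valued _ _ _ _ _ (tau k.+1)) //; last 2 first.
  by move=> S; exact: samples_measurable htau _ _ _.
  by move=> S; exact: sqr_ge0.
rewrite (bigID (fun S : {set 'I_m} => #|S| == beta)) /= [X in (_ + X)%E]big1.
  rewrite adde0 (eq_bigr (fun S => (p ^+ k.+1 * F S)%:E)) => [|S /eqP cS].
    rewrite sumEFin lee_fin -mulr_sumr exprSr -mulrA ler_pM2l ?exprn_gt0 //.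
    apply: skm_mean_step => // S i cS iS.
    have [pw'' tw''] := nextP _ cS.
    by rewrite -(xk _ pw''); apply: (skm_argmax_ge hx); rewrite tw''.
  by rewrite (prob_past_next htau) // -EFinM mulrC.
move=> S cS; rewrite (_ : _ `&` _ = set0) ?measure0 ?mule0 //.
apply/seteqP; split=> // w' [_ /= tS'].
by move: cS; rewrite -tS' (samples_card htau) ?eqxx.
Qed.

Lemma integral_past k w :
  (\int[Pr]_(w' in past_event tau k.+1 w) (dist2 k w')%:E
    = (p ^+ k * dist2 k w)%:E)%E.
Proof.
have mp : measurable (past_event tau k.+1 w).
  by rewrite past_eventE; exact: measurable_history htau _ _.
rewrite (eq_integral (cst (dist2 k w)%:E)) => [|w' /set_mem].
  rewrite integral_cst //=; have := prob_past htau k w => ->; by rewrite -EFinM mulrC.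
by rewrite past_eventE /dist2 => /iterate_history ->.
Qed.

Lemma measurable_dist2 k : measurable_fun setT (EFin \o dist2 k).
Proof.
pose F h := dist2 k (xget point (history tau k @^-1` [set h])).
have -> : dist2 k = fun w => F (history tau k w).
  apply/funext => w; rewrite /F /dist2.
  have /= hE := xgetPex point (ex_intro
    (history tau k @^-1` [set history tau k w]) w erefl).
  by rewrite (iterate_history hE).
apply/measurable_EFinP; apply: measurable_finite_valued.
exact: measurable_history htau _.
Qed.

(** The tower property, done by hand: the space is split along the histories of
    length [k], each of which is either impossible or the past of a point. *)
Lemma expectation_step k :
  (\int[Pr]_w (dist2 k.+1 w)%:E <= (rate m)%:E * \int[Pr]_w (dist2 k w)%:E)%E.
Proof.
have mh := @measurable_history _ _ _ _ _ _ _ htau k.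
rewrite !(integral_fibers Pr mh); last 4 first.
  exact: measurable_dist2.
  by move=> w; exact: sqr_ge0.
  exact: measurable_dist2.
  by move=> w; exact: sqr_ge0.
have hh h : exists r,
    (\int[Pr]_(w in history tau k @^-1` [set h]) (dist2 k w)%:E = r%:E)%E /\
    (\int[Pr]_(w in history tau k @^-1` [set h]) (dist2 k.+1 w)%:E
      <= (rate m * r)%:E)%E.
  have [->|/set0P[w <-]] := eqVneq (history tau k @^-1` [set h]) set0.
    by exists 0; rewrite !integral_set0 mulr0.
  rewrite -past_eventE; exists (p ^+ k * dist2 k w).
  rewrite integral_past; split=> //; apply: le_trans (integral_next_le k w) _.
  rewrite lee_fin mulrCA; apply: ler_wpM2r.
    by apply: mulr_ge0; [exact/exprn_ge0/ltW | exact: sqr_ge0].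
  have [L0 _] := hL; apply: contraction_rate_le => //.
    by case/andP: hlambda => l0 l2; nra.
  exact: skm_V_bounds.
pose r h := projT1 (cid (hh h)).
rewrite [X in (_ <= _ * X)%E](eq_bigr (fun h => (r h)%:E)); last first.
  by move=> h _; rewrite /r; case: cid => ? [].
rewrite sumEFin -EFinM mulr_sumr -sumEFin; apply: lee_sum => h _.
by rewrite /r; case: cid => ? [].
Qed.

End SKM.

(** * Linear convergence *)

(** The rate need not be assumed nonnegative: for a negative [q], nonnegativity
    of the sequence forces it to vanish identically. *)
Lemma geometric_decay (R : realDomainType) (q : R) (e : nat -> R) :
  (forall k, 0 <= e k) -> (forall k, e k.+1 <= q * e k) ->
  forall k, e k <= q ^+ k * e 0%N.
Proof.
move=> e0 eq k; have [q0|q0] := lerP 0 q.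
  elim: k => [|k IH]; first by rewrite expr0 mul1r.
  by rewrite exprS -mulrA (le_trans (eq k)) // ler_wpM2l.
have ez j : e j = 0.
  apply/eqP; rewrite eq_le e0 andbT -(nmulr_rge0 _ q0).
  exact: le_trans (eq j).
by rewrite !ez mulr0.
Qed.

Theorem theorem1 (R : realType) (m n : nat) (A : 'M[R]_(m, n)) (b : 'cV[R]_m)
    (lambda : R) (beta : nat) (x0 : 'cV[R]_n) (L2 : R)
    (d : measure_display) (Omega : measurableType d)
    (Pr : probability Omega R)
    (tau : nat -> Omega -> {set 'I_m}) (t : nat -> Omega -> 'I_m)
    (x : nat -> Omega -> 'cV[R]_n)
    (hA : forall i : 'I_m, enorm (arow A i) ^+ 2 = 1)
    (hP : feasible A b !=set0)
    (hlambda : 0 < lambda <= 2)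
    (hbeta : (1 <= beta <= m)%N)
    (htau : uniform_samples Pr beta tau)
    (hx : is_skm A b lambda x0 tau t x)
    (hL2 : hoffman_constant A b L2) :
  forall k : nat, (1 <= k)%N ->
    (forall w : Omega,
      (cond_expectation_past Pr tau k
         (fun w' => (edist (x k w') (feasible A b) ^+ 2)%R) w <=
       ((1 - (2 * lambda - lambda ^+ 2) /
               ((skm_V A b beta (x k.-1 w))%:R * L2 ^+ 2))
        * edist (x k.-1 w) (feasible A b) ^+ 2)%:E)%E) /\
    ('E_Pr[fun w => (edist (x k w) (feasible A b) ^+ 2)%R] <=
       ((1 - (2 * lambda - lambda ^+ 2) / (m%:R * L2 ^+ 2)) ^+ k
        * edist x0 (feasible A b) ^+ 2)%:E)%E.
Proof.
have hl : 0 <= lambda <= 2 by case/andP: hlambda => /ltW -> ->.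
have C0 : 0 < 'C(m, beta)%:R^-1 :> R.
  by rewrite invr_gt0 ltr0n bin_gt0; case/andP: hbeta.
case=> [//|k] _; split=> [w|].
  rewrite /cond_expectation_past (prob_past htau) -[k.+1.-1]/k /=.
  rewrite lee_pdivrMr ?exprn_gt0 //.
  rewrite -EFinM [X in (_ <= X%:E)%E]mulrC.
  exact: (integral_next_le hA hP hl hbeta htau hx hL2 k w).
pose I k := (\int[Pr]_w (edist (x k w) (feasible A b) ^+ 2)%:E)%E.
have I0 : I 0%N = (edist x0 (feasible A b) ^+ 2)%:E.
  rewrite /I; under eq_integral do rewrite (skm_init hx).
  by rewrite integral_cst //= probability_setT mule1.
have Istep j : (I j.+1 <= (1 - (2 * lambda - lambda ^+ 2) / (m%:R * L2 ^+ 2))%:E * I j)%E.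
  exact: (expectation_step hA hP hl hbeta htau hx hL2 j).
have Ige0 j : (0 <= I j)%E by apply: integral_ge0 => w _; rewrite lee_fin sqr_ge0.
have Ifin j : I j \is a fin_num.
  elim: j => [|j IH]; first by rewrite I0.
  rewrite ge0_fin_numE // (le_lt_trans (Istep j)) //.
  by rewrite -(fineK IH) -EFinM ltry.
rewrite unlock -/(I k.+1) -(fineK (Ifin _)) lee_fin.
have := @geometric_decay _ _ (fine \o I) _ _ k.+1; rewrite /= I0; apply=> j.
  exact: fine_ge0.
by rewrite -lee_fin EFinM !fineK.
Qed.
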